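(* Let $\ell>0$, $\Delta>0$, $\sigma>0$, let $T>1$ be an integer, let $0\le\beta_1\le1$, $0\le\beta_2<1$, $\gamma>0$, let $\frac12<\zeta<1$, and let the initial values $m_0\in\mathbb{R}^2$ and $v_0>0$ be given. Then there exist an $\ell$-smooth function $f:\mathbb{R}^2\to\mathbb{R}$, a point $x_0$ with $f(x_0)-\inf_x f(x)\le\Delta$, and a zero-mean gradient noise distribution $P$ with variance upper bounded by $\sigma^2$, such that if we run AMSGrad-norm with parameters $\beta_1,\beta_2$ and $\gamma_t=\frac{\gamma}{\sqrt{t+1}}$, then with probability at least $\frac12$, $$\min_{t\in\{0,1,\dots,T-1\}}\|\nabla f(x_t)\|\ge\sqrt{\frac{\Delta}{16\max\left\{\dfrac1\ell,\ \dfrac{\gamma\sqrt{2\,\Gamma\left(1-\frac{\zeta}{2}\right)}}{\sigma\left(e\left(\frac1\zeta-1\right)\right)^{\zeta/2}(1-\zeta)\sqrt{1-\beta_2}}\left(T^{1-\zeta}-\zeta\right)\right\}}},$$ where $\Gamma(\cdot)$ denotes the Gamma function.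
   Context: $\ell$-smooth means differentiable with $\ell$-Lipschitz gradient (Euclidean norm). The stochastic gradients $g(x;\xi)$ satisfy $\mathbb{E}_\xi[g(x;\xi)]=\nabla f(x)$ and $\mathbb{E}_\xi\|g(x;\xi)-\nabla f(x)\|^2\le\sigma^2$ for all $x$; the samples $\xi_t$ are drawn independently at each iteration. AMSGrad-norm: given $x_0$, parameters $\beta_1,\beta_2$, a sequence $\{\gamma_t\}$, initial momentum $m_0$ and $v_0>0$, set $\hat v_0=v_0$ and for $t=0,1,2,\dots$ sample $\xi_t$ and set $$m_{t+1}=\beta_1m_t+(1-\beta_1)g(x_t;\xi_t),\qquad v_{t+1}^2=\beta_2v_t^2+(1-\beta_2)\|g(x_t;\xi_t)\|^2,$$ $$\hat v_{t+1}^2=\max\{\hat v_t^2,v_{t+1}^2\},\qquad x_{t+1}=x_t-\frac{\gamma_t}{\sqrt{\hat v_{t+1}^2}}\,m_{t+1}.$$ *)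

(* Defs.v *)
(* MathComp-Analysis *)
From HB Require Import structures.
From mathcomp Require Export all_boot all_order all_algebra finmap.
From mathcomp Require Export all_classical all_reals all_analysis.
Set Implicit Arguments.
Unset Strict Implicit.
Unset Printing Implicit Defensive.

Export Order.TTheory GRing.Theory Num.Theory.
Export numFieldNormedType.Exports.

Local Open Scope classical_set_scope.
Local Open Scope ring_scope.

(* The library norm on 'rV[R]_n is the sup norm. It induces the same topology
   and the same differentials, but Lipschitz constants and variances are meant
   with respect to this one. *)
Definition enorm {R : realType} {n : nat} (x : 'rV[R]_n) : R :=
  Num.sqrt (\sum_(i < n) x 0 i ^+ 2).

Definition grad {R : realType} {n : nat} (f : 'rV[R]_n -> R) (x : 'rV[R]_n) :
    'rV[R]_n :=
  \row_(i < n) 'D_(delta_mx 0 i) f x.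

Definition smooth {R : realType} {n : nat} (l : R) (f : 'rV[R]_n -> R) : Prop :=
  (forall x, differentiable f x) /\
  (forall x y, enorm (grad f x - grad f y) <= l * enorm (x - y)).

(* Meaningful for 0 < s, where the integral converges. *)
Definition Gamma {R : realType} (s : R) : R :=
  \int[@lebesgue_measure R]_(u in `]0, +oo[) (u `^ (s - 1) * expR (- u)).

(* R^n with its Borel sigma-algebra *)
Definition borel_space (R : realType) (n : nat) :=
  g_sigma_algebraType (@open 'rV[R]_n).

Definition zero_mean {R : realType} {n : nat}
    (P : probability (borel_space R n) R) : Prop :=
  forall i : 'I_n,
    P.-integrable setT (fun z : 'rV[R]_n => (z 0 i)%:E) /\
    'E_P[fun z : 'rV[R]_n => z 0%R i]%E = 0%E.

(* E ||z||^2, which is the variance when P has zero mean *)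
Definition noise_variance {R : realType} {n : nat}
    (P : probability (borel_space R n) R) : \bar R :=
  'E_P[fun z : 'rV[R]_n => (enorm z ^+ 2)%R]%E.

Definition mutually_independent {d d'} {Omega : measurableType d}
    {S : measurableType d'} {R : realType} (Pr : probability Omega R)
    (X : nat -> {RV Pr >-> S}) : Prop :=
  forall (J : {fset nat}) (A : nat -> set S),
    (forall t, measurable (A t)) ->
    (Pr (\bigcap_(t in [set` J]) (X t @^-1` A t)) =
     \prod_(t <- J) Pr (X t @^-1` A t))%E.

Definition iid {d d'} {Omega : measurableType d} {S : measurableType d'}
    {R : realType} (Pr : probability Omega R) (X : nat -> {RV Pr >-> S})
    (P : probability S R) : Prop :=
  mutually_independent X /\
  (forall t (A : set S), measurable A -> distribution Pr (X t) A = P A).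

(* The second-moment fields hold the squares v_t^2 and \hat v_t^2. *)
Record ams_state (R : realType) (n : nat) := AmsState {
  pos : 'rV[R]_n ;
  mom : 'rV[R]_n ;
  vsq : R ;
  vhatsq : R }.

Definition ams_step {R : realType} {n : nat} (beta1 beta2 eta : R)
    (G : 'rV[R]_n) (s : ams_state R n) : ams_state R n :=
  let m := beta1 *: mom s + (1 - beta1) *: G in
  let v2 := beta2 * vsq s + (1 - beta2) * enorm G ^+ 2 in
  let vh2 := Num.max (vhatsq s) v2 in
  AmsState (pos s - (eta / Num.sqrt vh2) *: m) m v2 vh2.

(* State of AMSGrad-norm before iteration t, run with the stochastic gradient
   g, step sizes gam and the realized samples xi. *)
Fixpoint amsgrad_norm {R : realType} {n : nat} {S : Type} (beta1 beta2 : R)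
    (gam : nat -> R) (g : 'rV[R]_n -> S -> 'rV[R]_n) (x0 m0 : 'rV[R]_n) (v0 : R)
    (xi : nat -> S) (t : nat) : ams_state R n :=
  if t is t'.+1 then
    let s := amsgrad_norm beta1 beta2 gam g x0 m0 v0 xi t' in
    ams_step beta1 beta2 (gam t') (g (pos s) (xi t')) s
  else AmsState x0 m0 (v0 ^+ 2) (v0 ^+ 2).

(* Main.v *)
(** The objective depends on the first coordinate only. It is convex with
    derivative clamped to [0, c], where c is the claimed lower bound, and x_0
    lies on the part of constant slope c, at distance 15 c M from its end; here
    M is the maximum in the statement. Its orientation is chosen so that the
    initial momentum does not push towards the minimizers. The noise acts on
    the second coordinate: it only inflates the normalization. Since the
    relevant component of the momentum never exceeds c, the displacement is at
    most c times the sum of gamma_t / v-hat_{t+1}, and it remains to bound this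
    sum by 15 M with probability 1/2.

    The noise is (0, +-b) with b = c_x U^{-theta}, theta = zeta - 1/2, and U
    uniform on {1/T, 2/T, ..., 1}, so that its variance is at most
    c_x^2 / (1 - 2 theta) = sigma^2. The inverse of the maximum of k samples is
    the theta-th power of the minimum of k copies of U, divided by c_x; this
    minimum has mean at most 2/k, hence by concavity the mean of its theta-th
    power is at most (2/k)^theta. As k^{-1/2} k^{-theta} = k^{-zeta}, the sum has
    mean of order T^{1-zeta}, and Markov's inequality concludes. The remaining
    constants are absorbed by Gamma(1 - zeta/2) >= 1/e. *)
Require Import Defs.
From HB Require Import structures.
From mathcomp Require Import measurable_realfun ring lra.
Set Implicit Arguments.
Unset Strict Implicit.
Unset Printing Implicit Defensive.

Local Open Scope classical_set_scope.
Local Open Scope ring_scope.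

(** * Power sums *)

Lemma bernoulli_powR (R : realType) (r y : R) : 0 < r < 1 -> 0 <= y ->
  y `^ r <= 1 - r + r * y.
Proof.
move=> /andP[r0 r1] y0.
have r1' : 0 < 1 - r by rewrite subr_gt0.
have := @conjugate_powR R (y `^ r) 1 r^-1 (1 - r)^-1 (powR_ge0 _ _) ler01.
rewrite !invr_gt0 !invrK mulr1 powR1 -powRrM mulfV ?gt_eqF// powRr1//.
by move=> /(_ r0 r1') H; apply: (le_trans (H _)); lra.
Qed.

(** Concavity again: the tangent bound at the ratio n/(n+1), multiplied by (n+1)^r. The case n = 0
    is included, with ratio 0. *)
Lemma powR_nat_step (R : realType) (r : R) (n : nat) : 0 < r < 1 ->
  r * n.+1%:R `^ (r - 1) <= n.+1%:R `^ r - n%:R `^ r.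
Proof.
move=> r01; have n0 : 0 < n.+1%:R :> R by rewrite ltr0n.
have -> : n%:R = n.+1%:R * (n%:R / n.+1%:R) :> R by rewrite mulrC divfK ?gt_eqF.
have q0 : 0 <= n%:R / n.+1%:R :> R by rewrite divr_ge0// ?ler0n.
rewrite (powRM _ (ltW n0) q0) powRB; last by apply/implyP => _; rewrite gt_eqF.
rewrite (powRr1 (ltW n0)).
have := bernoulli_powR r01 q0.
have -> : n%:R / n.+1%:R = 1 - n.+1%:R^-1 :> R.
  apply: (mulIf (lt0r_neq0 n0)).
  by rewrite divfK ?gt_eqF// mulrBl mulVf ?gt_eqF// mul1r -natr1 addrK.
have := powR_gt0 r n0; set P := _ `^ r; set Q := _ `^ r => P0 HQ.
move: (_^-1) HQ => i HQ; have := ler_wpM2l (ltW P0) HQ; lra.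
Qed.

Lemma sum_powR_le (R : realType) (r : R) (n : nat) : 0 < r < 1 ->
  r * \sum_(j < n) j.+1%:R `^ (r - 1) <= n%:R `^ r.
Proof.
move=> r01; elim: n => [|n IHn]; first by rewrite big_ord0 mulr0 powR_ge0.
rewrite big_ord_recr/= mulrDr; have := powR_nat_step n r01; lra.
Qed.

(** Telescoping starts at the first term, which is exactly 1, and not at 0; this is the origin of
    the [- z] in the rate. *)
Lemma sum_powRN_le (R : realType) (z : R) (n : nat) : 0 < z < 1 -> (0 < n)%N ->
  \sum_(j < n) j.+1%:R `^ (- z) <= (n%:R `^ (1 - z) - z) / (1 - z).
Proof.
move=> z01; case: n => [//|n] _.
have z1 : 0 < 1 - z by lra.
have r01 : 0 < 1 - z < 1 by lra.
rewrite ler_pdivlMr// mulrC; elim: n => [|n IHn].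
  by rewrite big_ord1 !powR1; lra.
rewrite big_ord_recr/= mulrDr; have := powR_nat_step n.+1 r01.
rewrite (_ : 1 - z - 1 = - z); last by ring.
lra.
Qed.

Lemma sum_expr_le (R : realType) (n N : nat) :
  n.+1%:R * \sum_(k < N) k%:R ^+ n <= N%:R ^+ n.+1 :> R.
Proof.
elim: N => [|N IHN]; first by rewrite big_ord0 mulr0 exprn_ge0.
rewrite big_ord_recr/= mulrDr.
apply: (le_trans (lerD IHN (lexx _))).
(* The first two terms of the binomial expansion of (N+1)^(n+1) suffice; the others are
   nonnegative. *)
rewrite -[in leRHS]natr1 exprDn 2!big_ord_recl/= /bump/= subn0 subn1/=.
rewrite !expr1n !mulr1 bin0 bin1 mulr1n.
by rewrite lerD2l mulr_natl lerDl sumr_ge0.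
Qed.

(** * The Gamma function *)

Section Gamma.
Context (R : realType).
Local Notation mu := (@lebesgue_measure R).

Lemma powR_derivable (s x : R) : 0 < x -> derivable (@powR R ^~ s) x 1.
Proof. by move=> x0; apply: derivable_powR; rewrite in_itv/= x0. Qed.

Lemma powR_continuous (s x : R) : 0 < x -> {for x, continuous (@powR R ^~ s)}.
Proof.
move=> x0; apply: differentiable_continuous; apply/derivable1_diffP.
exact: powR_derivable.
Qed.

(** The cut-off [a] keeps the primitive away from its singularity at 0. The bound does not depend on
    [a], so it survives the limit. *)
Lemma integral_powR_le (s a : R) : 0 < s -> 0 < a < 1 ->
  (\int[mu]_(u in `[a, 1%R]) (u `^ (s - 1))%:E <= s^-1%:E)%E.
Proof.
move=> s0 /andP[a0 a1].
have pos u : a <= u -> 0 < u by exact: lt_le_trans.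
have contF u : 0 < u -> {for u, continuous (fun u : R => s^-1 * u `^ s)}.
  by move=> u0; apply: cvgMr; exact: powR_continuous.
rewrite (@continuous_FTC2 _ _ (fun u => s^-1 * u `^ s))//.
- rewrite -EFinB lee_fin powR1 mulr1 lerBlDr lerDl.
  by rewrite mulr_ge0 ?powR_ge0// invr_ge0 ltW.
- apply: continuous_in_subspaceT => u; rewrite inE/= in_itv/= => /andP[au _].
  by apply: powR_continuous; exact: pos.
- split.
  + move=> u; rewrite in_itv/= => /andP[au _].
    by apply: derivableM => //; apply: powR_derivable; apply: pos; exact: ltW.
  + by apply: cvg_at_right_filter; exact: contF.
  + by apply: cvg_at_left_filter; exact: contF.
- move=> u; rewrite in_itv/= => /andP[au _].
  have u0 := pos _ (ltW au).
  rewrite derive1Ml; last exact: powR_derivable.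
  by rewrite powR_derive1 ?in_itv/= ?u0// mulrA mulVf ?mul1r// gt_eqF.
Qed.

Let h (s u : R) := u `^ (s - 1) * expR (- u).

Let mh s (D : set R) : measurable_fun D (fun u => (h s u)%:E).
Proof.
apply/measurable_EFinP; apply: measurable_funTS; apply: measurable_funM.
  exact: measurable_powR.
by apply: measurableT_comp => //; exact: measurable_expR.
Qed.

Let h_ge0 s u : (0 <= (h s u)%:E)%E.
Proof. by rewrite lee_fin mulr_ge0 ?powR_ge0 ?expR_ge0. Qed.

(** [Gamma] is the real part of an extended integral and would be 0 if that integral were infinite.
    Near 0 the integrand is below u^(s-1), and beyond 1 it is below the exponential density. *)
Lemma Gamma_integral_fin (s : R) : 0 < s <= 1 ->
  (\int[mu]_(u in `]0%R, +oo[) (h s u)%:E < +oo)%E.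
Proof.
move=> /andP[s0 s1].
have -> : `]0, +oo[%classic = `]0, 1] `|` `]1, +oo[%classic :> set R.
  by rewrite -itv_bndbnd_setU ?bnd_simp.
rewrite ge0_integral_setU//=; last first.
  apply/disj_setPS => u [] /=; rewrite !in_itv/= andbT => /andP[_ u1].
  by rewrite ltNge u1.
  exact: mh.
rewrite lte_add_pinfty//.
(* The left ends 1/(n+2) stay strictly below 1, as [integral_powR_le] requires. *)
- have -> : `]0, 1]%classic = \bigcup_n `[n.+2%:R^-1, 1]%classic :> set R.
    apply/seteqP; split => [u /=|u [n _] /=]; rewrite !in_itv/=.
      move=> /andP[u0 u1]; exists (Num.truncn u^-1) => //=; rewrite in_itv/= u1 andbT.
      rewrite invf_ple ?posrE ?ltr0n// ltW// (lt_trans (truncnS_gt _))//.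
      by rewrite ltr_nat.
    by move=> /andP[nu ->]; rewrite (lt_le_trans _ nu)// invr_gt0 ltr0n.
  set F := fun n => _.
  have ndF : nondecreasing_seq F.
    move=> m n mn; rewrite /F subsetEset => u /=; rewrite !in_itv/=.
    move=> /andP[mu_ ->]; rewrite andbT (le_trans _ mu_)//.
    by rewrite lef_pV2 ?posrE ?ltr0n// ler_nat !ltnS.
  have mF n : measurable (F n : set (measurableTypeR R)) by exact: measurable_itv.
  have mhF n : measurable_fun (F n) (fun u : measurableTypeR R => (h s u)%:E).
    exact: mh.
  have hF0 n (u : measurableTypeR R) : F n u -> (0 <= (h s u)%:E)%E by [].
  have := ge0_nondecreasing_set_cvg_integral (mu := mu) ndF mF mhF hF0.
  move=> /cvg_lim <-//; apply: (@le_lt_trans _ _ s^-1%:E); last exact: ltry.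
  apply: lime_le.
    apply: ereal_nondecreasing_is_cvgn.
    move=> m n mn; apply: ge0_subset_integral => //.
      exact: mh.
    by rewrite -subsetEset; exact: ndF.
  apply: nearW => n; apply: (le_trans _ (@integral_powR_le s n.+2%:R^-1 s0 _)).
    apply: ge0_le_integral => //=.
    - exact: mh.
    - by apply/measurable_EFinP; apply: measurable_funTS; exact: measurable_powR.
    - move=> u; rewrite /F/= in_itv/= => /andP[nu _]; rewrite lee_fin /h.
      rewrite ler_piMr ?powR_ge0// -expR0 ler_expR oppr_le0.
      by rewrite (le_trans _ nu)// invr_ge0.
  by rewrite invr_gt0 ltr0n/= invf_lt1 ?ltr0n// ltr1n.
- apply: (@le_lt_trans _ _ 1%E); last exact: ltry.
  rewrite -(@integral_exponential_pdf R 1 ltr01).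
  apply: (@le_trans _ _ (\int[mu]_(u in `]1%R, +oo[) (exponential_pdf 1 u)%:E)%E).
    apply: ge0_le_integral => //=.
    + exact: mh.
    + by apply/measurable_EFinP; apply: measurable_funTS; exact: measurable_exponential_pdf.
    + move=> u; rewrite in_itv/= andbT => u1; rewrite lee_fin.
      rewrite exponential_pdfE; last by rewrite (le_trans ler01)// ltW.
      rewrite /h mul1r mulN1r ler_piMl ?expR_ge0// -[leRHS](powRr0 u).
      by rewrite ler_powR ?(ltW u1)// subr_le0.
  apply: ge0_subset_integral => //=.
  + by apply/measurable_EFinP; exact: measurable_exponential_pdf.
  + by move=> u _; rewrite lee_fin exponential_pdf_ge0.
Qed.

(** On ]0, 1] the power is at least 1, because s <= 1, and the exponential is at least 1/e. *)
Lemma Gamma_ge (s : R) : 0 < s <= 1 -> expR (- 1) <= Gamma s.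
Proof.
move=> s01; rewrite -lee_fin /Gamma /Rintegral fineK; last first.
  rewrite ge0_fin_numE; first exact: Gamma_integral_fin.
  by apply: integral_ge0 => u _; exact: h_ge0.
apply: (@le_trans _ _ (\int[mu]_(u in `]0%R, 1%R]) (h s u)%:E)%E); last first.
  apply: ge0_subset_integral => //=; first exact: mh.
  by apply: subset_itvl; rewrite bnd_simp.
apply: (@le_trans _ _ (\int[mu]_(u in `]0%R, 1%R]) (cst (expR (-1))%:E u))%E).
  by rewrite integral_cst//= lebesgue_measure_itv/= lte01 sube0 mule1.
apply: ge0_le_integral => //=.
- exact: mh.
- move=> u; rewrite in_itv/= => /andP[u0 u1]; rewrite lee_fin.
  rewrite -[leLHS]mul1r ler_pM ?expR_ge0 ?ler_expR ?lerN2//.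
  rewrite -[leLHS](powRr0 u) ger_powR ?u0//.
  by move: s01; lra.
Qed.

End Gamma.

(** Cube of the inverse of e^(-1/3) >= 1 - 1/3. *)
Lemma expR1_le (R : realType) : expR 1 <= (3 / 2) ^+ 3 :> R.
Proof.
rewrite -[in leLHS](@mulfV _ (3%:R : R)) ?pnatr_eq0// expRM_natl.
have : 1 + (- 3^-1) <= expR (- 3^-1) :> R by exact: expR_ge1Dx.
have e0 := expR_gt0 (3^-1 : R).
rewrite expRN => He; rewrite lerXn2r ?nnegrE ?(ltW e0)//.
rewrite -[leLHS]invrK invf_ple ?posrE ?invr_gt0//; lra.
Qed.

(** The exponent is q ln(1/q), and ln(1/q) < 1/q. *)
Lemma powRN_self_le (R : realType) (q : R) : 0 < q -> q `^ (- q) <= expR 1.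
Proof.
move=> q0; rewrite /powR gt_eqF// ler_expR mulNr -mulrN -lnV ?posrE//.
rewrite mulrC -ler_pdivlMr// div1r.
by rewrite ltW// ln_sublinear// invr_gt0.
Qed.

(** Both sides are compared through their squares. Since e/z >= 1, (e/z)^z <= e/z <= 2e; and (1-z)^z
    = (1-z) (1-z)^(-(1-z)) <= e (1-z). The left square is thus at most 8 e^2 (1-z), the right one is
    450 G (1-z), and eG >= 1 reduces the claim to 8 e^3 <= 450. *)
Lemma rate_constant_le (R : realType) (z G : R) : 1 / 2 < z < 1 ->
  expR (- 1) <= G ->
  2 * (expR 1 * (1 / z - 1)) `^ (z / 2) <= 15 * Num.sqrt (2 * G) * Num.sqrt (1 - z).
Proof.
move=> /andP[z12 z1] hG.
have z0 : 0 < z by lra.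
have q0 : 0 < 1 - z by lra.
have e0 : 0 < expR 1 :> R by exact: expR_gt0.
have e1 : 1 <= expR 1 :> R by rewrite -expR0 ler_expR.
have e4 := expR1_le R.
have G0 : 0 < G by apply: lt_le_trans hG; exact: expR_gt0.
have eG : 1 <= expR 1 * G.
  by apply: le_trans (ler_wpM2l (ltW e0) hG); rewrite -expRD subrr expR0.
have ez1 : 1 <= expR 1 / z by rewrite ler_pdivlMr// mul1r; lra.
have ez2 : expR 1 / z <= 2 * expR 1.
  rewrite ler_pdivrMr//; nra.
have -> : expR 1 * (1 / z - 1) = expR 1 / z * (1 - z) by field; rewrite gt_eqF.
have A0 : 0 <= expR 1 / z * (1 - z) by rewrite mulr_ge0//; lra.
rewrite powRrM powR12_sqrt ?powR_ge0// powRM; [|lra|lra].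
have H1 : (expR 1 / z) `^ z <= 2 * expR 1.
  by apply: le_trans ez2; rewrite ler1_powR// ltW.
have H2 : (1 - z) `^ z <= (1 - z) * expR 1.
  rewrite -[X in _ `^ X](subKr 1) powRB ?(gt_eqF q0) ?implybT//.
  by rewrite (powRr1 (ltW q0)) -powRN ler_pM2l// powRN_self_le.
have E2 : 2 = Num.sqrt (2 ^+ 2) :> R by rewrite sqrtr_sqr ger0_norm.
have E15 : 15 = Num.sqrt (15 ^+ 2) :> R by rewrite sqrtr_sqr ger0_norm.
rewrite [in leLHS]E2 [in leRHS]E15 {E2 E15}.
rewrite -!sqrtrM ?mulr_ge0 ?exprn_ge0 ?(ltW G0)//.
rewrite ler_wsqrtr//.
apply: (@le_trans _ _ (2 ^+ 2 * ((2 * expR 1) * ((1 - z) * expR 1)))).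
  by rewrite ler_pM2l// ler_pM ?powR_ge0.
have -> : 2 ^+ 2 * (2 * expR 1 * ((1 - z) * expR 1)) = (8 * expR 1 ^+ 2) * (1 - z) by ring.
rewrite ler_pM2r//.
have : 8 * expR 1 ^+ 3 <= 450 * (expR 1 * G) :> R.
  apply: (@le_trans _ _ (8 * ((3 / 2) ^+ 3) ^+ 3)); last by lra.
  by rewrite ler_pM2l// lerXn2r ?nnegrE ?(ltW e0)//; lra.
nra.
Qed.

(** * A convex function with gradient clamped to [0, l a] *)

Section huber.
Context (R : realType).
Implicit Types (a x y t l s : R).

(** A quadratic bound on the Taylor remainder treats the kinks of the derivative like all other
    points. *)
Lemma is_derive_quad (V : normedModType R) (f : V -> R) (x v : V) (d K : R) :
  (forall t, `|f (x + t *: v) - f x - t * d| <= K * t ^+ 2) -> is_derive x v f d.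
Proof.
move=> H.
have K0 : 0 <= K by have := H 1; rewrite expr1n mulr1; exact: le_trans.
have cvd : (fun h : R => h^-1 *: ((f \o shift x) (h *: v) - f x)) @ 0^' --> d.
  apply/cvgrPdist_le => e e0; near=> t.
  have t0 : t != 0 by near: t; exact: nbhs_dnbhs_neq.
  (* K may be 0, hence the [+ 1]. *)
  have te : `|t| <= e / (K + 1).
    by near: t; apply: dnbhs0_le; rewrite divr_gt0// ltr_wpDl.
  rewrite /= -normrN opprB.
  have -> : t^-1 *: (f (t *: v + x) - f x) - d =
            t^-1 * (f (x + t *: v) - f x - t * d).
    by rewrite (addrC x) mulrBr mulKf.
  rewrite normrM normfV ler_pdivrMl ?normr_gt0//.
  apply: (le_trans (H t)).
  rewrite -normr_id -[t ^+ 2]ger0_norm ?sqr_ge0// normrX expr2 normr_id mulrCA.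
  rewrite ler_wpM2l//.
  apply: (le_trans (ler_wpM2l K0 te)).
  by rewrite mulrCA ler_piMr// ?(ltW e0)// ler_pdivrMr ?mul1r ?lerDl// ltr_wpDl.
by split; [apply/cvg_ex; exists d|apply/cvg_lim].
Unshelve. all: by end_near. Qed.

(* clamp a truncates to [0, a] and huber a is its primitive: 0 on the left of 0,
   x^2/2 on [0, a], of constant slope a on the right of a. *)
Definition clamp a x := Num.max x 0 - Num.max (x - a) 0.
Definition huber a x := (Num.max x 0 ^+ 2 - Num.max (x - a) 0 ^+ 2) / 2.

(** The Taylor remainder of max(y,0)^2 lies between 0 and t^2; that of [huber] is half the
    difference of two such remainders. *)
Lemma huber_taylor a x t :
  `|huber a (x + t) - huber a x - t * clamp a x| <= t ^+ 2.
Proof.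
rewrite /huber /clamp.
have key y : 0 <= Num.max (y + t) 0 ^+ 2 - Num.max y 0 ^+ 2
                - 2 * t * Num.max y 0 <= t ^+ 2.
  rewrite /Num.max; case: ltP => yt; case: ltP => y0; apply/andP; split.
  - by rewrite expr0n/= mulr0 !subr0.
  - by rewrite expr0n/= mulr0 !subr0 sqr_ge0.
  - have := mulr_ge0 y0 (_ : 0 <= - y - 2 * t); have : 0 <= - y - 2 * t by lra.
    by move=> h /(_ h); lra.
  - have := sqr_ge0 (y + t); lra.
  - by rewrite expr0n/= mulr0 !subr0 sqr_ge0.
  - by rewrite expr0n/= mulr0 !subr0 lerXn2r ?nnegrE//; lra.
  - have := sqr_ge0 t; lra.
  - by lra.
have /andP[A1 A2] := key x; have /andP[B1 B2] := key (x - a).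
rewrite (addrAC x t) ler_norml; apply/andP; split; lra.
Qed.

Lemma clamp_lipschitz a x y : 0 <= a -> `|clamp a x - clamp a y| <= `|x - y|.
Proof.
move=> a0; rewrite /clamp /Num.max ler_norml.
case: ltP => ?; case: ltP => ?; case: ltP => ?; case: ltP => ?;
  case: ger0P => ?; apply/andP; split; lra.
Qed.

Lemma clamp_le a x : 0 <= a -> clamp a x <= a.
Proof. by move=> a0; rewrite /clamp /Num.max; case: ltP => ?; case: ltP => ?; lra. Qed.

Lemma clamp_id a x : 0 <= a -> a <= x -> clamp a x = a.
Proof. by move=> a0 ax; rewrite /clamp /Num.max; case: ltP => ?; case: ltP => ?; lra. Qed.

Lemma huber_ge0 a x : 0 <= a -> 0 <= huber a x.
Proof. by move=> a0; rewrite /huber /Num.max; case: ltP => ?; case: ltP => ?; nra. Qed.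

Lemma huber_ge a x : 0 <= a -> a <= x -> huber a x = a * x - a ^+ 2 / 2.
Proof. by move=> a0 ax; rewrite /huber /Num.max; case: ltP => ?; case: ltP => ?; nra. Qed.

Lemma measurable_clamp a : measurable_fun setT (clamp a).
Proof.
apply: measurable_funB; apply: measurable_maxr => //.
exact: measurable_funB.
Qed.

Lemma enorm2E (z : 'rV[R]_2) : enorm z ^+ 2 = z 0 0 ^+ 2 + z 0 1 ^+ 2.
Proof.
rewrite /enorm sqr_sqrtr ?sumr_ge0// => [|i _]; last exact: sqr_ge0.
by rewrite big_ord_recl big_ord1; congr (_ + z _ _ ^+ 2); apply: val_inj.
Qed.

Lemma enorm_ge0 n (z : 'rV[R]_n) : 0 <= enorm z.
Proof. exact: sqrtr_ge0. Qed.

(* The orientation s is 1 or -1. *)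
Definition plateau l a s (x : 'rV[R]_2) : R := l * huber a (s * x 0 0).

Lemma plateau_is_derive l a s (x v : 'rV[R]_2) : 0 <= l ->
  is_derive x v (plateau l a s) (l * clamp a (s * x 0 0) * (s * v 0 0)).
Proof.
move=> l0; apply: (@is_derive_quad _ _ _ _ _ (l * (s * v 0 0) ^+ 2)) => t.
rewrite /plateau !mxE mulrDr (mulrCA s t).
move: (s * x 0 0) (s * v 0 0) => u w.
have := ler_wpM2l l0 (huber_taylor a u (t * w)).
rewrite -{1}[l]ger0_norm// -normrM; congr (`|_| <= _); ring.
Qed.

Lemma plateau_differentiable l a s (x : 'rV[R]_2) : 0 <= l -> differentiable (plateau l a s) x.
Proof.
move=> l0.
have -> : plateau l a s = (fun y => l * huber a (s * y)) \o (fun z : 'rV[R]_2 => z 0 0).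
  by [].
apply: differentiable_comp; first exact: differentiable_coord.
apply/derivable1_diffP.
suff : is_derive (x 0 0) 1 (fun y => l * huber a (s * y)) (l * clamp a (s * x 0 0) * s).
  by case.
apply: (@is_derive_quad _ _ _ _ _ (l * s ^+ 2)) => t.
rewrite mulrDr [t *: 1]mulr1; move: (s * x 0 0) => u.
have := ler_wpM2l l0 (huber_taylor a u (s * t)).
rewrite -{1}[l]ger0_norm// -normrM; congr (`|_| <= _); ring.
Qed.

Lemma grad_plateau l a s (x : 'rV[R]_2) : 0 <= l ->
  grad (plateau l a s) x = (l * clamp a (s * x 0 0) * s) *: delta_mx 0 0.
Proof.
move=> l0; apply/rowP => i; rewrite !mxE.
have [_ ->] := plateau_is_derive a s x (delta_mx 0 i) l0.
by rewrite mxE eqxx/= (eq_sym 0 i) mulrA.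
Qed.

Lemma smooth_plateau l a s : 0 < l -> 0 <= a -> s ^+ 2 = 1 ->
  smooth l (plateau l a s).
Proof.
move=> l0 a0 s1; split=> [x|x y]; first exact/plateau_differentiable/ltW.
rewrite !(grad_plateau _ _ _ (ltW l0)) -scalerBl -(ler_pXn2r (ltn0Sn 1)) ?nnegrE ?enorm_ge0//; last first.
  by rewrite mulr_ge0 ?enorm_ge0// ltW.
rewrite exprMn !enorm2E !mxE !eqxx/= mulr0 expr0n addr0 mulr1.
rewrite -mulrBl -mulrBr 2!exprMn s1 mulr1 ler_pM2l ?exprn_gt0//.
apply: (@le_trans _ _ ((x 0 0 - y 0 0) ^+ 2)); last by rewrite lerDl sqr_ge0.
have := clamp_lipschitz (s * x 0 0) (s * y 0 0) a0.
rewrite -mulrBr => H.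
rewrite -[leRHS]mul1r -s1 -exprMn.
by rewrite -[leLHS]real_normK ?num_real// -[leRHS]real_normK ?num_real// lerXn2r ?nnegrE.
Qed.

End huber.

(** * The noise distribution *)

Section uniform_seq.
Context d (T : measurableType d) (R : realType).
Variables (s : nat -> T) (n : nat).

Definition uniform_seq : set T -> \bar R :=
  mscale (n.+1%:R^-1)%:nng (msum (fun i => dirac (s i)) n.+1).

HB.instance Definition _ := Measure.on uniform_seq.

Let uniform_seq_setT : uniform_seq setT = 1%E.
Proof.
rewrite /uniform_seq/= /mscale/= /msum/=. rewrite (eq_bigr (fun=> 1%:E)).
  by rewrite sumEFin sumr_const card_ord -EFinM mulVf// pnatr_eq0.
by move=> i _; rewrite diracT.
Qed.

HB.instance Definition _ := Measure_isProbability.Build _ _ _ uniform_seq uniform_seq_setT.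

Lemma ge0_integral_uniform_seq (f : T -> \bar R) :
  measurable_fun setT f -> (forall x, 0 <= f x)%E ->
  (\int[uniform_seq]_x f x = (n.+1%:R^-1)%:E * \sum_(i < n.+1) f (s i))%E.
Proof.
move=> mf f0; rewrite ge0_integral_mscale//= ge0_integral_measure_sum//.
by congr (_ * _)%E; apply: eq_bigr => i _; rewrite integral_dirac// diracT mul1e.
Qed.

Lemma uniform_seqE (A : set T) :
  uniform_seq A = (n.+1%:R^-1 * \sum_(i < n.+1) \1_A (s i))%:E.
Proof. by rewrite /uniform_seq/= /mscale/= /msum/= EFinM -sumEFin. Qed.

End uniform_seq.

Lemma sum_double (V : nmodType) (F : nat -> V) n :
  \sum_(i < n.*2) F i = \sum_(j < n) (F j.*2 + F j.*2.+1).
Proof.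
elim: n => [|n IHn]; first by rewrite !big_ord0.
by rewrite doubleS !big_ord_recr/= IHn addrA.
Qed.

Section borel_space.
Context (R : realType).
Local Notation S := (borel_space R 2).

Lemma continuous_borel_measurable (f : 'rV[R]_2 -> R) : continuous f ->
  measurable_fun setT (f : S -> R).
Proof.
move=> /continuousP cf; apply: (measurability _ (RGenOpens.measurableE R)).
move=> _ [_ [x [y ->]] <-]; rewrite setTI; apply: sub_sigma_algebra.
exact/cf/interval_open.
Qed.

Lemma measurable_coord (i : 'I_2) : measurable_fun setT (fun z : S => z 0 i : R).
Proof. by apply: continuous_borel_measurable; exact: coord_continuous. Qed.

Lemma measurable_enorm : measurable_fun setT (fun z : S => enorm z ^+ 2 : R).
Proof.
under eq_fun do rewrite enorm2E.
by apply: measurable_funD; apply: measurable_funX; exact: measurable_coord.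
Qed.

End borel_space.

Section noise.
Context (R : realType).
Variables (b : nat -> R) (n : nat).
Local Notation S := (borel_space R 2).

(* The points 2j and 2j+1 are opposite to each other, at distance b j from 0. *)
Definition noise_point (i : nat) : S := ((-1) ^+ odd i * b i./2) *: delta_mx 0 1.

(** [uniform_seq] with parameter m has m+1 points, so 2n+1 yields n+1 opposite pairs. *)
Definition noise : probability S R := uniform_seq R noise_point n.*2.+1.

Lemma noise_pointE i j : noise_point i 0 j = (-1) ^+ odd i * b i./2 * (j == 1)%:R.
Proof. by rewrite !mxE. Qed.

(** Opposite points exchange the positive and negative parts of a coordinate, so both have the same
    finite integral. *)
Lemma noise_zero_mean : zero_mean noise.
Proof.
move=> i; set f : S -> \bar R := fun z => (z 0 i)%:E.
have mf : measurable_fun setT f by apply/measurable_EFinP; exact: measurable_coord.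
have fE k : f (noise_point k.*2.+1) = (- f (noise_point k.*2))%E.
  rewrite /f !noise_pointE /= odd_double doubleK uphalf_double/=.
  by rewrite expr0 expr1 !mulN1r mul1r mulNr.
have posneg : (\int[noise]_x f^\+ x = \int[noise]_x f^\- x)%E.
  rewrite !ge0_integral_uniform_seq//; [|exact: measurable_funeneg|exact: measurable_funepos].
  congr (_ * _)%E; rewrite -doubleS !(sum_double (fun i => _ (noise_point i))).
  apply: eq_bigr => k _; rewrite addrC; congr (_ + _)%E.
    by rewrite funeposE funenegE fE.
  by rewrite funeposE funenegE fE oppeK.
have fin : (\int[noise]_x f^\- x \is a fin_num)%E.
  rewrite ge0_integral_uniform_seq//; last exact: measurable_funeneg.
  rewrite fin_numM// sum_fin_num; apply/allP => _ /mapP[k _ ->].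
  by rewrite funenegE /f /maxe; case: ifP.
split.
  apply/integrableP; split => //.
  rewrite (eq_integral (f^\+ \+ f^\-)%E); last first.
    by move=> z _; rewrite -[RHS]/((f^\+ \+ f^\-)%E z) -fune_abse.
  rewrite ge0_integralD//; [|exact: measurable_funepos|exact: measurable_funeneg].
  by rewrite posneg lte_add_pinfty// -ge0_fin_numE ?integral_ge0.
by rewrite unlock integralE posneg subee.
Qed.

Lemma noise_varianceE :
  noise_variance noise = (n.+1%:R^-1 * \sum_(j < n.+1) b j ^+ 2)%:E.
Proof.
rewrite /noise_variance unlock ge0_integral_uniform_seq//; last 2 first.
- by apply/measurable_EFinP; exact: measurable_enorm.
- by move=> z; rewrite lee_fin sqr_ge0.
rewrite sumEFin -EFinM -doubleS; congr EFin.
rewrite (sum_double (fun i => enorm (noise_point i) ^+ 2)).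
rewrite -muln2 natrM invfM -mulrA; congr (_ * _).
rewrite mulr_sumr; apply: eq_bigr => k _.
rewrite !enorm2E !noise_pointE/= !mulr0 expr0n/= !add0r !mulr1 !exprMn.
by rewrite odd_double uphalf_double doubleK/= expr0 expr1 sqrrN expr1n mul1r; field.
Qed.

Lemma noise_proba (A : set R) : (forall y, A (- y) <-> A y) ->
  noise [set z : 'rV[R]_2 | A (z 0 1)] = (n.+1%:R^-1 * \sum_(j < n.+1) \1_A (b j))%:E.
Proof.
move=> Asym; rewrite [LHS]uniform_seqE -doubleS; congr EFin.
rewrite (sum_double (fun i => \1_(_) (noise_point i))).
rewrite -muln2 natrM invfM -mulrA; congr (_ * _).
rewrite mulr_sumr; apply: eq_bigr => k _.
have AE i : \1_[set z : 'rV[R]_2 | A (z 0 1)] (noise_point i) = \1_A (b i./2) :> R.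
  rewrite !indicE; congr (nat_of_bool _)%:R; apply/idP/idP; rewrite !inE/= noise_pointE mulr1;
    case: (odd i); rewrite ?expr0 ?expr1 ?mulN1r ?mul1r//; by rewrite Asym.
by rewrite !AE/= uphalf_double doubleK; field.
Qed.

End noise.

(** * Markov's inequality *)

Section mean_le.
Context d (T : measurableType d) (R : realType) (P : probability T R).
Implicit Types (X Y : T -> R) (e k : R).

(** Measurability and sign are bundled with the bound so that such estimates can be added and scaled
    without side conditions until Markov's inequality is applied. *)
Definition mean_le X e :=
  [/\ measurable_fun setT X, forall w, 0 <= X w & (\int[P]_w (X w)%:E <= e%:E)%E].

Lemma mean_le_cst k : 0 <= k -> mean_le (cst k) k.
Proof.
move=> k0; split => //.
have -> : (\int[P]_w (cst k w)%:E = k%:E * P setT)%E by exact: (integral_cst P measurableT k%:E).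
by rewrite probability_setT mule1.
Qed.

Lemma mean_le_indic (A : set T) e : measurable A -> (P A <= e%:E)%E ->
  mean_le \1_A e.
Proof.
move=> mA PA; split => //.
by rewrite integral_indic// setIT.
Qed.

Lemma mean_leD X Y e1 e2 : mean_le X e1 -> mean_le Y e2 ->
  mean_le (fun w => X w + Y w) (e1 + e2).
Proof.
move=> [mX X0 IX] [mY Y0 IY]; split.
- exact: measurable_funD.
- by move=> w; rewrite addr_ge0.
- under eq_integral do rewrite EFinD.
  rewrite ge0_integralD//; first by rewrite EFinD leeD.
  - by move=> w _; rewrite lee_fin.
  - exact/measurable_EFinP.
  - by move=> w _; rewrite lee_fin.
  - exact/measurable_EFinP.
Qed.

Lemma mean_leZ X k e : 0 <= k -> mean_le X e -> mean_le (fun w => k * X w) (k * e).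
Proof.
move=> k0 [mX X0 IX]; split.
- exact: measurable_funM.
- by move=> w; rewrite mulr_ge0.
- under eq_integral do rewrite EFinM.
  rewrite ge0_integralZl_EFin//; first by rewrite EFinM lee_wpmul2l.
  - by move=> w _; rewrite lee_fin.
  - exact/measurable_EFinP.
Qed.

Lemma mean_le_sum n (X : nat -> T -> R) (e : nat -> R) :
  (forall i, (i < n)%N -> mean_le (X i) (e i)) ->
  mean_le (fun w => \sum_(i < n) X i w) (\sum_(i < n) e i).
Proof.
elim: n => [_|n IHn H].
  by rewrite big_ord0; under eq_fun do rewrite big_ord0; exact: mean_le_cst.
rewrite big_ord_recr/=; under eq_fun do rewrite big_ord_recr/=.
by apply: mean_leD; [apply: IHn => i /ltnW; exact: H|exact: H].
Qed.

Lemma mean_le_trans X e1 e2 : e1 <= e2 -> mean_le X e1 -> mean_le X e2.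
Proof. by move=> e12 [mX X0 IX]; split => //; apply: le_trans IX _; rewrite lee_fin. Qed.

(** Markov on the complement: X >= a outside B, so a P(~B) <= e <= a/2. *)
Lemma probability_ge_half X e a (B : set T) : mean_le X e -> 0 < a -> 2 * e <= a ->
  measurable B -> (forall w, X w < a -> B w) -> ((1 / 2)%:E <= P B)%E.
Proof.
move=> [mX X0 IX] a0 ea mB XB.
have PC : (a%:E * P (~` B) <= e%:E)%E.
  have mBC : measurable (~` B) by exact: measurableC.
  rewrite -(setIT (~` B)) -integral_indic// -ge0_integralZl_EFin ?(ltW a0)//; last first.
    exact/measurable_EFinP.
  apply: le_trans IX; apply: ge0_le_integral => //.
  - by move=> w _; rewrite -EFinM lee_fin mulr_ge0// ltW.
  - by apply/measurable_EFinP; exact: measurable_funM.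
  - exact/measurable_EFinP.
  move=> w _; rewrite -EFinM lee_fin indicE.
  have [|] := boolP (w \in ~` B); last by rewrite mulr0.
  by rewrite inE/= mulr1 => Bw; rewrite leNgt; apply/negP => /XB.
rewrite probability_setC// in PC.
have Pfin : P B \is a fin_num by exact: fin_num_measure.
move: PC; rewrite -(fineK Pfin) -EFinB -EFinM !lee_fin => PC.
rewrite ler_pdivrMr//; nra.
Qed.

End mean_le.

(** * Maxima of the noise *)

Lemma iid_all d d' (Omega : measurableType d) (S : measurableType d')
    (R : realType) (Pr : probability Omega R) (X : nat -> {RV Pr >-> S})
    (P : probability S R) (A : set S) (n : nat) (p : R) :
  iid X P -> measurable A -> P A = p%:E ->
  Pr [set w | forall s, (s < n)%N -> A (X s w)] = (p ^+ n)%:E.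
Proof.
move=> [indX distX] mA PA.
have := indX [fset i in iota 0 n]%fset (fun=> A) (fun=> mA).
rewrite (eq_bigr (fun=> p%:E)) => [H|t _]; last by rewrite -PA -(distX t A mA).
transitivity (\prod_(t <- [fset i in iota 0 n]%fset) p%:E)%E.
  rewrite -H; congr (Pr _); apply/seteqP; split => w /=.
    by move=> Aw t /=; rewrite !inE/= mem_iota => /andP[_ tn]; exact: Aw.
  by move=> Aw s sn; apply: Aw; rewrite /= !inE/= mem_iota.
rewrite prodEFin; congr EFin.
rewrite big_const_seq count_predT iter_mulr_1.
by have := card_fseq (iota 0 n); rewrite undup_id ?iota_uniq// size_iota => ->.
Qed.

Section levels.
Context (R : realType).
Variables (c th : R) (n : nat).
Hypotheses (c0 : 0 < c) (th0 : 0 < th) (th1 : th < 1 / 2).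

(* The value of c U^(-th) for U = (j+1)/(n+1), decreasing in j. *)
Definition noise_level (j : nat) : R := c * (j.+1%:R / n.+1%:R) `^ (- th).

Lemma level_anti i j : (i <= j)%N -> noise_level j <= noise_level i.
Proof.
move=> ij; rewrite /noise_level ler_pM2l// !powRN lef_pV2 ?posrE ?powR_gt0 ?divr_gt0//.
apply: ge0_ler_powR; rewrite ?nnegrE ?divr_ge0 ?(ltW th0)//.
by rewrite ler_pM2r ?invr_gt0// ler_nat.
Qed.

Lemma level_last : noise_level n = c.
Proof. by rewrite /noise_level divff ?pnatr_eq0// powR1 mulr1. Qed.

Lemma level_gt0 j : 0 < noise_level j.
Proof. by rewrite mulr_gt0// powR_gt0// divr_gt0. Qed.

(** A Riemann sum of the integral of u^(-2 th) over (0, 1], which converges because 2 th < 1. *)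
Lemma level_variance : n.+1%:R^-1 * \sum_(j < n.+1) noise_level j ^+ 2 <=
  c ^+ 2 / (1 - 2 * th).
Proof.
have r01 : 0 < 1 - 2 * th < 1.
  by move: th0 th1 => h0 h1; lra.
have N0 : 0 < n.+1%:R :> R by [].
have H := sum_powR_le n.+1 r01.
rewrite (_ : 1 - 2 * th - 1 = - (2 * th)) in H; last by ring.
have E : \sum_(j < n.+1) noise_level j ^+ 2 =
    c ^+ 2 * n.+1%:R `^ (2 * th) * \sum_(j < n.+1) j.+1%:R `^ (- (2 * th)).
  rewrite mulr_sumr; apply: eq_bigr => j _; rewrite /noise_level exprMn -mulrA; congr (_ * _).
  rewrite -powR_mulrn ?powR_ge0// -powRrM powRM ?invr_ge0//.
  rewrite -powR_inv1// -powRrM mulrC; congr (_ `^ _ * _ `^ _); ring.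
rewrite E ler_pdivlMr; last by case/andP: r01.
set s := \sum_(j < _) _ in H *.
rewrite powRB in H; last by apply/implyP => _; rewrite gt_eqF.
rewrite (powRr1 (ltW N0)) in H.
rewrite ler_pdivlMr ?powR_gt0// in H.
have -> : n.+1%:R^-1 * (c ^+ 2 * n.+1%:R `^ (2 * th) * s) * (1 - 2 * th) =
  c ^+ 2 * (((1 - 2 * th) * s * n.+1%:R `^ (2 * th)) / n.+1%:R) by ring.
rewrite ler_piMr ?sqr_ge0// ler_pdivrMr// mul1r; exact: H.
Qed.

(** Levels decrease with their index, so only the n - j indices above j can contribute. *)
Lemma noise_below j : (j <= n)%N ->
  exists2 p : R, noise noise_level n [set z : 'rV[R]_2 | `|z 0 1| < noise_level j] = p%:E &
    0 <= p <= (n - j)%:R / n.+1%:R.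
Proof.
move=> jn.
rewrite (noise_proba noise_level n (A := [set y | `|y| < noise_level j])) => [|y /=]; last by rewrite normrN.
eexists; first reflexivity.
rewrite mulrC divr_ge0 ?sumr_ge0//= ler_pM2r ?invr_gt0//.
have -> : \sum_(i < n.+1) \1_[set y | `|y| < noise_level j] (noise_level i) =
    \sum_(0 <= i < n.+1) \1_[set y | `|y| < noise_level j] (noise_level i) :> R.
  by rewrite big_mkord.
rewrite (big_cat_nat (n := j.+1))//= big_nat big1 ?add0r => [|i /andP[_ ij]].
  apply: (@le_trans _ _ (\sum_(j.+1 <= i < n.+1) 1)).
    by apply: ler_sum => i _; rewrite indicE lern1 leq_b1.
  by rewrite sumr_const_nat subSS.
rewrite indicE memNset//= ger0_norm ?(ltW (level_gt0 _))// ltNge.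
by move=> /negP; apply; exact: level_anti.
Qed.

End levels.

(** * The minimum of the uniform variables behind the first k samples *)

Section rank.
Context d (Omega : measurableType d) (R : realType) (Pr : probability Omega R).
Variables (xi : nat -> {RV Pr >-> borel_space R 2}).
Variables (c th : R) (n : nat).
Hypotheses (c0 : 0 < c) (th0 : 0 < th) (th1 : th < 1 / 2).
Local Notation level := (noise_level c th n).

Lemma measurable_all (A : set (borel_space R 2)) (k : nat) : measurable A ->
  measurable [set w | forall s, (s < k)%N -> A (xi s w)].
Proof.
move=> mA.
have -> : [set w | forall s, (s < k)%N -> A (xi s w)] =
    \bigcap_s (if (s < k)%N then xi s @^-1` A else setT).
  apply/seteqP; split=> w /= H s => [_|sk]; first by case: ifPn => // sk; exact: H.
  by have := H s Logic.I; rewrite sk.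
apply: bigcapT_measurable => s; case: ifP => // _.
by rewrite -[X in measurable X]setTI; exact: measurable_funPT.
Qed.

Lemma measurable_coord_lt (y : R) :
  measurable ([set z | `|z 0 1| < y] : set (borel_space R 2)).
Proof.
have mN : measurable_fun setT (fun z : borel_space R 2 => `|z 0 1| : R).
  by apply: measurableT_comp => //; exact: measurable_coord.
have := mN measurableT `]-oo, y[%classic (measurable_itv _).
by rewrite setTI; congr measurable; apply/seteqP; split => z /=; rewrite in_itv.
Qed.

(* If the samples are c U_s^(-th), this is the minimum of U_s over s < k. *)
Definition rank (k : nat) (w : Omega) : R := n.+1%:R^-1 *
  (1 + \sum_(j < n)
    \1_[set w | forall s, (s < k)%N -> `|xi s w 0 1| < level j] w).

(** The mean is the sum of the tails. By independence the tail at j is at most ((n-j)/(n+1))^k, and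
    summing gives at most 1/(n+1) + 1/(k+1). Both terms are at most 1/k, the first because k <=
    n+1. *)
Lemma rank_mean k : iid xi (noise level n) -> (0 < k <= n.+1)%N ->
  mean_le Pr (rank k) (2 / k%:R).
Proof.
move=> ix /andP[k0 kn].
pose q (j : nat) : R := ((n - j)%:R / n.+1%:R) ^+ k.
have N0 : 0 < n.+1%:R :> R by [].
have K0 : 0 < k%:R :> R by rewrite ltr0n.
have : mean_le Pr (rank k) (n.+1%:R^-1 * (1 + \sum_(j < n) q j)).
  apply: mean_leZ; first by rewrite invr_ge0.
  apply: mean_leD; first exact: mean_le_cst.
  apply: (mean_le_sum (X := fun j => \1_[set w | forall s, (s < k)%N -> `|xi s w 0 1| < level j])).
  move=> j jn; have [p Pp /andP[p0 pq]] := noise_below c0 th0 (ltnW jn).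
  have mA := measurable_coord_lt (level j).
  apply: mean_le_indic; first exact: (measurable_all k mA).
  rewrite (iid_all k ix mA Pp) lee_fin.
  by rewrite lerXn2r ?nnegrE// divr_ge0.
apply: mean_le_trans.
(* Reversal of the order of summation; the added term i = 0 vanishes because k > 0. *)
have Sq : \sum_(j < n) q j = n.+1%:R ^- k * \sum_(i < n.+1) i%:R ^+ k.
  rewrite big_ord_recl expr0n eqn0Ngt k0/= add0r mulr_sumr.
  rewrite (reindex_inj rev_ord_inj)/=; apply: eq_bigr => i _.
  by rewrite /q /= subKn// expr_div_n mulrC.
rewrite Sq.
have S0 := @sum_expr_le R k n.+1.
set T := \sum_(i < _) _ in S0 *.
have T1 : n.+1%:R^-1 * (n.+1%:R ^- k * T) <= k.+1%:R^-1.
  by rewrite mulrA -invfM -exprS mulrC ler_pdivrMr ?exprn_gt0// mulrC ler_pdivlMr// mulrC.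
have T2 : k.+1%:R^-1 <= k%:R^-1 :> R by rewrite lef_pV2 ?posrE ?ltr0n// ler_nat.
have T3 : n.+1%:R^-1 <= k%:R^-1 :> R by rewrite lef_pV2 ?posrE ?ltr0n// ler_nat.
rewrite mulrDr mulr1 mulr_natl mulr2n lerD//.
exact: le_trans T1 T2.
Qed.

(** Let i be the first index with level at most m; it exists because the last level is c. For j < i
    every sample lies below level j, so [rank] counts j and is at least (i+1)/(n+1), while 1/m is at
    most the inverse of level i. *)
Lemma inv_le_rank k w (m : R) : (forall s, (s < k)%N -> `|xi s w 0 1| <= m) ->
  c <= m -> m^-1 <= c^-1 * rank k w `^ th.
Proof.
move=> Hm cm.
have ex : exists i, level i <= m by exists n; rewrite level_last.
set i := ex_minn ex.
have [im imin] : level i <= m /\ forall j, level j <= m -> (i <= j)%N.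
  by rewrite /i; case: ex_minnP.
have iN : (i <= n)%N by apply: imin; rewrite level_last.
have N0 : 0 < n.+1%:R :> R by [].
apply: (@le_trans _ _ (level i)^-1).
  by rewrite lef_pV2 ?posrE ?level_gt0// (lt_le_trans _ cm).
rewrite /noise_level invfM -powRN opprK ler_pM2l ?invr_gt0//.
apply: ge0_ler_powR; rewrite ?(ltW th0)// ?nnegrE ?divr_ge0//.
  by rewrite /rank mulr_ge0 ?addr_ge0// sumr_ge0.
rewrite /rank mulrC ler_pM2l ?invr_gt0// -natr1 addrC lerD2l.
rewrite -[X in X%:R <= _]card_ord -sumr_const.
rewrite (big_ord_widen _ (fun=> 1) iN) big_mkcond.
apply: ler_sum => j _; case: ifPn => // ji.
rewrite indicE mem_set//= => s sk; apply: (le_lt_trans (Hm _ sk)).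
by rewrite ltNge; apply/negP => /imin; rewrite leqNgt ji.
Qed.

(** The tangent at [a] replaces Jensen's inequality: the bound is linear in [rank], so its mean is
    immediate. *)
Lemma inv_le_rank_lin k w (m a : R) : 0 < a ->
  (forall s, (s < k)%N -> `|xi s w 0 1| <= m) -> c <= m ->
  m^-1 <= c^-1 * (a `^ th * (1 - th + th / a * rank k w)).
Proof.
move=> a0 Hm cm; apply: (le_trans (inv_le_rank Hm cm)).
rewrite ler_pM2l ?invr_gt0//.
have r0 : 0 <= rank k w by rewrite /rank mulr_ge0 ?addr_ge0 ?invr_ge0// sumr_ge0.
have {1}-> : rank k w = a * (rank k w / a) by rewrite mulrCA divff ?gt_eqF// mulr1.
rewrite powRM ?divr_ge0 ?(ltW a0)// ler_pM2l ?powR_gt0//.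
rewrite -mulrA (mulrC a^-1); apply: bernoulli_powR; rewrite ?divr_ge0 ?(ltW a0)//.
by move: th0 th1 => h0 h1; lra.
Qed.

End rank.

(** * Markov's inequality for the sum of inverse maxima *)

Section noise_sum.
Context d (Omega : measurableType d) (R : realType) (Pr : probability Omega R).
Variables (xi : nat -> {RV Pr >-> borel_space R 2}).
Variables (c th : R) (n : nat).
Hypotheses (c0 : 0 < c) (th0 : 0 < th) (th1 : th < 1 / 2).
Hypothesis iid_xi : iid xi (noise (noise_level c th n) n).

(* These points are outside the support, but a sample may still take them. *)
Let bad : set (borel_space R 2) := ~` ([set z | z 0 0 = 0] `\` [set z | `|z 0 1| < c]).

Let measurable_bad : measurable bad.
Proof.
apply: measurableC; apply: measurableD; last exact: measurable_coord_lt.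
have := @measurable_coord R 0 measurableT [set 0] (measurable_set1 _).
by rewrite setTI.
Qed.

Let noise_bad : noise (noise_level c th n) n bad = 0%:E.
Proof.
rewrite [LHS]uniform_seqE big1 ?mulr0// => i _.
rewrite indicE memNset// => nb; apply: nb; split => /=.
  by rewrite noise_pointE mulr0.
rewrite noise_pointE mulr1 normrM normrX normrN1 expr1n mul1r.
rewrite ger0_norm; last exact/ltW/level_gt0.
apply/negP; rewrite -leNgt -[leLHS](level_last c th n); apply: level_anti => //.
by rewrite -ltnS ltn_half_double.
Qed.

(** The sequence m is left arbitrary so that the normalization of the algorithm can take its place
    later. *)
Lemma noise_sum_half (K : nat) (L : R) (B : set Omega) : (K <= n.+1)%N -> 0 < L ->
  2 * \sum_(k < K) (Num.sqrt k.+1%:R)^-1 * (c^-1 * (2 / k.+1%:R) `^ th) <= L ->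
  measurable B ->
  (forall w, (forall s, (s < K)%N -> xi s w 0 0 = 0) ->
    (forall m : nat -> R,
      (forall k s, (k < K)%N -> (s <= k)%N -> `|xi s w 0 1| <= m k) ->
      \sum_(k < K) (Num.sqrt k.+1%:R)^-1 / m k < L) -> B w) ->
  ((1 / 2)%:E <= Pr B)%E.
Proof.
move=> Kn L0 HL mB HB.
pose a k : R := 2 / k.+1%:R.
have a0 k : 0 < a k by rewrite divr_gt0.
pose X k w := (Num.sqrt k.+1%:R)^-1 *
  (c^-1 * (a k `^ th * (1 - th + th / a k * rank xi c th n k.+1 w))).
pose Z s w := L * \1_(xi s @^-1` bad) w.
(* The terms Z s have mean 0 and rule out bad samples on the event Y < L. *)
pose Y w := \sum_(k < K) X k w + \sum_(s < K) Z s w.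
have X0 k w : 0 <= X k w.
  have t0 : 0 <= 1 - th by move: th1 => h1; lra.
  rewrite !mulr_ge0 ?invr_ge0 ?sqrtr_ge0 ?powR_ge0 ?(ltW c0)//.
  rewrite (addr_ge0 t0)// mulr_ge0 ?divr_ge0 ?(ltW (a0 k)) ?(ltW th0)//.
  by rewrite /rank mulr_ge0 ?addr_ge0 ?invr_ge0// sumr_ge0.
have Z0 s w : 0 <= Z s w by rewrite mulr_ge0// ltW.
have mY : mean_le Pr Y (\sum_(k < K) (Num.sqrt k.+1%:R)^-1 * (c^-1 * a k `^ th)).
  rewrite -[X in mean_le _ _ X]addr0; apply: mean_leD.
    apply: (mean_le_sum (e := fun k => (Num.sqrt k.+1%:R)^-1 * (c^-1 * a k `^ th))).
    move=> k kK; apply: mean_leZ; first by rewrite invr_ge0 sqrtr_ge0.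
    apply: mean_leZ; first by rewrite invr_ge0 ltW.
    (* [rank] has mean at most [a k], so the tangent has mean at most 1 - th + (th / a k) * a k =
       1. *)
    rewrite -[X in mean_le _ _ X]mulr1.
    apply: mean_leZ; first exact: powR_ge0.
    rewrite -[X in mean_le _ _ X](subrK th).
    apply: mean_leD.
      by apply: mean_le_cst; move: th1 => h1; lra.
    rewrite -[X in mean_le _ _ X](divfK (lt0r_neq0 (a0 k))).
    apply: mean_leZ; first by rewrite divr_ge0 ?ltW.
    by apply: rank_mean => //=; exact: leq_trans Kn.
  rewrite [X in mean_le _ _ X](_ : 0 = \sum_(s < K) 0); last by rewrite big1.
  apply: (mean_le_sum (e := fun=> 0)) => s sK.
  rewrite -[X in mean_le _ _ X](mulr0 L); apply: mean_leZ; first exact: ltW.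
  apply: mean_le_indic; first by rewrite -[X in measurable X]setTI; exact: measurable_funPT.
  by have [_ /(_ s _ measurable_bad)] := iid_xi; rewrite noise_bad => <-.
apply: (probability_ge_half mY L0 HL mB) => w YL.
have good s : (s < K)%N -> ~ bad (xi s w).
  move=> sK bs; move: YL; apply/negP; rewrite -leNgt /Y.
  have Zs : Z s w = L by rewrite /Z indicE mem_set ?mulr1.
  rewrite [X in _ + X](bigD1 (Ordinal sK))//= Zs.
  by rewrite addrCA lerDl addr_ge0// sumr_ge0.
have good0 s : (s < K)%N -> xi s w 0 0 = 0 by move=> /good/contrapT[].
have good1 s : (s < K)%N -> c <= `|xi s w 0 1|.
  by move=> /good/contrapT[_ /negP]; rewrite -leNgt.
apply: HB => // m Hm; apply: le_lt_trans YL.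
rewrite /Y -[leLHS]addr0; apply: lerD; last exact: sumr_ge0.
apply: ler_sum => k _; rewrite ler_wpM2l ?invr_ge0 ?sqrtr_ge0//.
apply: inv_le_rank_lin => //.
  by move=> s sk; exact: Hm.
by apply: (le_trans (good1 0 _)); [case: (K) k => [[]|]|exact: Hm].
Qed.

End noise_sum.

(** * AMSGrad-norm on the plateau *)

Section dynamics.
Context (R : realType).
Variables (l a s beta1 beta2 v0 : R) (gam : nat -> R) (x0 m0 : 'rV[R]_2).
Hypotheses (l0 : 0 < l) (a0 : 0 <= a) (s1 : s ^+ 2 = 1).
Local Notation f := (plateau l a s).
Implicit Types (z : nat -> borel_space R 2) (t : nat).

Lemma enorm_grad_plateau x : enorm (grad f x) = l * `|clamp a (s * x 0 0)|.
Proof.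
apply/eqP; rewrite -(eqrXn2 (ltn0Sn 1)) ?enorm_ge0 ?mulr_ge0 ?(ltW l0)//.
rewrite enorm2E grad_plateau ?ltW// !mxE !eqxx/= mulr0 expr0n addr0 mulr1.
by rewrite !exprMn real_normK ?num_real// s1 mulr1.
Qed.

Definition ams_run (z : nat -> borel_space R 2) (t : nat) : ams_state R 2 :=
  amsgrad_norm beta1 beta2 gam (fun x w : 'rV[R]_2 => grad f x + w) x0 m0 v0 z t.

Lemma grad_noise_coord0 x (w : 'rV[R]_2) :
  (grad f x + w) 0 0 = l * clamp a (s * x 0 0) * s + w 0 0.
Proof. by rewrite grad_plateau ?ltW// !mxE !eqxx mulr1. Qed.

Lemma grad_noise_coord1 x (w : 'rV[R]_2) : (grad f x + w) 0 1 = w 0 1.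
Proof. by rewrite grad_plateau ?ltW// !mxE eqxx/= mulr0 add0r. Qed.

(** Without noise in the first coordinate, each momentum is a convex combination of quantities at
    most l a. *)
Lemma run_mom z t : 0 <= beta1 <= 1 -> s * m0 0 0 <= 0 ->
  (forall k, (k < t)%N -> z k 0 0 = 0) -> s * mom (ams_run z t) 0 0 <= l * a.
Proof.
move=> /andP[b0 b1] sm0; have la : 0 <= l * a by rewrite mulr_ge0// ltW.
elim: t => [_|t IHt zt]; first exact: le_trans la.
have {}IHt : s * mom (ams_run z t) 0 0 <= l * a by apply: IHt => k /ltnW; exact: zt.
rewrite /ams_run /= -/(ams_run z t) mxE [X in _ + X]mxE [X in X + _]mxE grad_noise_coord0.
rewrite zt// addr0; set y := mom _ _ _ in IHt *.
set q := clamp _ _.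
have qa : q <= a by exact: clamp_le.
have -> : s * (beta1 * y + (1 - beta1) * (l * q * s)) =
  beta1 * (s * y) + (1 - beta1) * (l * q * s ^+ 2) by ring.
rewrite s1 mulr1.
have H1 := ler_wpM2l b0 IHt.
have H2 : (1 - beta1) * (l * q) <= (1 - beta1) * (l * a).
  by rewrite ler_wpM2l ?subr_ge0// ler_pM2l.
by apply: (le_trans (lerD H1 H2)); lra.
Qed.

Lemma run_vsq z t : 0 <= beta2 < 1 -> 0 <= vsq (ams_run z t).
Proof.
move=> /andP[b0 b1]; elim: t => [|t IHt]; first exact: sqr_ge0.
by rewrite addr_ge0// mulr_ge0 ?sqr_ge0// subr_ge0 ltW.
Qed.

Lemma run_vhatsq_gt0 z t : 0 < v0 -> 0 < vhatsq (ams_run z t).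
Proof.
move=> v00; elim: t => [|t IHt]; first by rewrite exprn_gt0.
by rewrite /= lt_max IHt.
Qed.

(** The running maximum retains every past gradient. The objective has no slope along the second
    coordinate, so the gradient norm is at least the noise there. *)
Lemma run_vhatsq z t k : 0 <= beta2 < 1 -> (k < t)%N ->
  (1 - beta2) * z k 0 1 ^+ 2 <= vhatsq (ams_run z t).
Proof.
move=> b01; elim: t => [//|t IHt]; rewrite ltnS leq_eqVlt => /predU1P[->|kt]; last first.
  by rewrite /= le_max IHt.
rewrite /= -/(ams_run z t) le_max; apply/orP; right.
move: (b01) => /andP[b0 b1].
have := mulr_ge0 b0 (run_vsq z t b01).
have : (1 - beta2) * z t 0 1 ^+ 2 <=
    (1 - beta2) * enorm (grad f (pos (ams_run z t)) + z t) ^+ 2.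
  rewrite ler_pM2l ?subr_gt0// enorm2E grad_noise_coord1.
  by rewrite lerDr sqr_ge0.
by lra.
Qed.

Lemma run_pos z t : 0 <= beta1 <= 1 -> s * m0 0 0 <= 0 -> (forall k, 0 <= gam k) ->
  (forall k, (k < t)%N -> z k 0 0 = 0) ->
  s * x0 0 0 - l * a * \sum_(k < t) gam k / Num.sqrt (vhatsq (ams_run z k.+1)) <=
  s * pos (ams_run z t) 0 0.
Proof.
move=> b01 sm0 g0; elim: t => [_|t IHt zt]; first by rewrite big_ord0 mulr0 subr0.
have {}IHt := IHt (fun k kt => zt k (ltnW kt)).
have mt := run_mom b01 sm0 zt.
rewrite big_ord_recr; pose e := gam t / Num.sqrt (vhatsq (ams_run z t.+1)).
have e0 : 0 <= e by rewrite divr_ge0// sqrtr_ge0.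
have -> : s * pos (ams_run z t.+1) 0 0 =
  s * pos (ams_run z t) 0 0 - e * (s * mom (ams_run z t.+1) 0 0).
  by rewrite [pos _]/= mxE [X in _ + X]mxE [X in - X]mxE -/(ams_run z t) mulrBr mulrCA.
rewrite mulrDr opprD addrA; apply: lerB => //.
by rewrite [leRHS]mulrC; exact: (ler_wpM2l e0 mt).
Qed.

Lemma run_grad_ge z t D : 0 <= beta1 <= 1 -> s * m0 0 0 <= 0 -> (forall k, 0 <= gam k) ->
  s * x0 0 0 = a + l * a * D ->
  (forall k, (k < t)%N -> z k 0 0 = 0) ->
  \sum_(k < t) gam k / Num.sqrt (vhatsq (ams_run z k.+1)) <= D ->
  l * a <= enorm (grad f (pos (ams_run z t))).
Proof.
move=> b01 sm0 g0 x0E zt HD; rewrite enorm_grad_plateau clamp_id//.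
  by rewrite ger0_norm.
apply: le_trans (run_pos b01 sm0 g0 zt); rewrite x0E.
have la : 0 <= l * a by rewrite mulr_ge0// ltW.
have := ler_wpM2l la HD; lra.
Qed.

(** * Measurability of the event *)

Section measurability.
Context d (Omega : measurableType d).
Variable xi : nat -> Omega -> borel_space R 2.
Hypothesis mxi : forall t, measurable_fun setT (xi t).
Hypothesis v00 : 0 < v0.

Let st t w := ams_run (fun k => xi k w) t.

(** The gradient depends only on the first coordinate of the position, so the induction closes on
    these four quantities. *)
Lemma measurable_run t : [/\
  measurable_fun setT (fun w => pos (st t w) 0 0),
  measurable_fun setT (fun w => mom (st t w) 0 0),
  measurable_fun setT (fun w => vsq (st t w)) &
  measurable_fun setT (fun w => vhatsq (st t w))].
Proof.
elim: t => [|t [mp mm mv mvh]]; first by split.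
have mz i : measurable_fun setT (fun w => xi t w 0 i : R).
  exact: (measurableT_comp (f := fun z : borel_space R 2 => z 0 i : R) (measurable_coord i) (mxi t)).
have mG0 : measurable_fun setT (fun w => (grad f (pos (st t w)) + xi t w) 0 0 : R).
  under eq_fun do rewrite grad_noise_coord0.
  apply: measurable_funD => //; apply: measurable_funM => //.
  apply: measurable_funM => //; apply: measurableT_comp; first exact: measurable_clamp.
  exact: measurable_funM.
have mm' : measurable_fun setT (fun w => mom (st t.+1 w) 0 0).
  rewrite (_ : (fun w => _) = fun w => beta1 * mom (st t w) 0 0 +
      (1 - beta1) * (grad f (pos (st t w)) + xi t w) 0 0); last first.
    by apply/funext => w; rewrite [mom _]/= !mxE.
  by apply: measurable_funD; apply: measurable_funM.
have mv' : measurable_fun setT (fun w => vsq (st t.+1 w)).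
  rewrite (_ : (fun w => _) = fun w => beta2 * vsq (st t w) + (1 - beta2) *
      ((grad f (pos (st t w)) + xi t w) 0 0 ^+ 2 + xi t w 0 1 ^+ 2)); last first.
    by apply/funext => w; rewrite [vsq _]/= enorm2E grad_noise_coord1.
  apply: measurable_funD; apply: measurable_funM => //.
  by apply: measurable_funD; apply: measurable_funX.
have mvh' : measurable_fun setT (fun w => vhatsq (st t.+1 w)).
  exact: measurable_maxr.
split => //.
(* The power -1/2 stands for the inverse square root, as real powers are known to be measurable. *)
rewrite (_ : (fun w => _) = fun w => pos (st t w) 0 0 -
    gam t * (vhatsq (st t.+1 w)) `^ (- 2^-1) * mom (st t.+1 w) 0 0); last first.
  apply/funext => w; rewrite powRN powR12_sqrt; last exact/ltW/run_vhatsq_gt0.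
  by rewrite [pos _]/= mxE [X in _ + X]mxE [X in - X]mxE.
apply: measurable_funB => //; apply: measurable_funM => //; apply: measurable_funM => //.
exact: (measurableT_comp (measurable_powR (- 2^-1)) mvh').
Qed.

Lemma measurable_grad_ge (c : R) (T : nat) :
  measurable [set w | forall t, (t < T)%N -> c <= enorm (grad f (pos (st t w)))].
Proof.
have -> : [set w | forall t, (t < T)%N -> c <= enorm (grad f (pos (st t w)))] =
    \bigcap_t (if (t < T)%N then
      (fun w => enorm (grad f (pos (st t w)))) @^-1` `[c, +oo[%classic else setT).
  apply/seteqP; split=> w /= H t => [_|tT].
    by case: ifPn => // tT /=; rewrite in_itv/= H.
  by have := H t Logic.I; rewrite tT/= in_itv/= andbT.
apply: bigcapT_measurable => t; case: ifP => // _.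
rewrite -[X in measurable X]setTI.
suff : measurable_fun setT (fun w => enorm (grad f (pos (st t w)))).
  by apply => //; exact: measurable_itv.
under eq_fun do rewrite enorm_grad_plateau.
apply: measurable_funM => //; apply: measurableT_comp => //.
apply: measurableT_comp; first exact: measurable_clamp.
by apply: measurable_funM => //; have [] := measurable_run t.
Qed.

End measurability.
End dynamics.

(** * The lower bound *)

(** The exponents 1/2 and z - 1/2 add up to z, and 2^(z - 1/2) <= sqrt 2. *)
Lemma weighted_sum_le (R : realType) (z c : R) (T : nat) : 1 / 2 < z < 1 -> 0 < c ->
  (0 < T)%N ->
  \sum_(k < T) (Num.sqrt k.+1%:R)^-1 * (c^-1 * (2 / k.+1%:R) `^ (z - 1 / 2)) <=
  Num.sqrt 2 / c * ((T%:R `^ (1 - z) - z) / (1 - z)).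
Proof.
move=> /andP[z12 z1] c0 T0.
have z01 : 0 < z < 1 by lra.
have s2c : 0 <= Num.sqrt 2 / c by rewrite divr_ge0 ?sqrtr_ge0// ltW.
apply: le_trans (ler_wpM2l s2c (sum_powRN_le z01 T0)).
rewrite mulr_sumr; apply: ler_sum => k _.
rewrite powRM ?invr_ge0// -[k.+1%:R^-1]powR_inv1// -powRrM mulN1r.
have -> : (Num.sqrt k.+1%:R)^-1 = k.+1%:R `^ (- 2^-1) :> R.
  by rewrite powRN powR12_sqrt.
have -> : k.+1%:R `^ (- z) = k.+1%:R `^ (- 2^-1) * k.+1%:R `^ (- (z - 1 / 2)) :> R.
  rewrite -powRD; last by apply/implyP => _; rewrite pnatr_eq0.
  by congr (_ `^ _); field.
rewrite [leLHS](_ : _ = c^-1 * (2 `^ (z - 1 / 2)) *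
  (k.+1%:R `^ (- 2^-1) * k.+1%:R `^ (- (z - 1 / 2)))); last by ring.
rewrite ler_wpM2r ?mulr_ge0 ?powR_ge0// mulrC ler_wpM2r ?invr_ge0 ?(ltW c0)//.
by rewrite -powR12_sqrt// ler_powR; lra.
Qed.

(** The factors sqrt 2 cancel; after removal of the common factors, [rate_constant_le] remains. *)
Lemma rate_le (R : realType) (gamma sigma beta2 z U G : R) :
  0 < gamma -> 0 < sigma -> beta2 < 1 -> 1 / 2 < z < 1 -> 0 <= U ->
  expR (- 1) <= G ->
  gamma / Num.sqrt (1 - beta2) *
    (2 * (Num.sqrt 2 / (sigma * (Num.sqrt 2 * Num.sqrt (1 - z))) * (U / (1 - z)))) <=
  15 * (gamma * Num.sqrt (2 * G) /
    (sigma * (expR 1 * (1 / z - 1)) `^ (z / 2) * (1 - z) * Num.sqrt (1 - beta2)) * U).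
Proof.
move=> g0 s0 b1 z01 U0 hG; have := rate_constant_le z01 hG.
case/andP: z01 => z12 z1.
have z0 : 0 < z by lra.
have q0 : 0 < 1 - z by lra.
have A0 : 0 < (expR 1 * (1 / z - 1)) `^ (z / 2).
  rewrite powR_gt0// mulr_gt0 ?expR_gt0// subr_gt0 ltr_pdivlMr// mul1r; lra.
have B0 : 0 < Num.sqrt (1 - beta2) by rewrite sqrtr_gt0 subr_gt0.
have C0 : 0 < Num.sqrt (1 - z) by rewrite sqrtr_gt0.
have D0 : 0 < Num.sqrt 2 :> R by rewrite sqrtr_gt0.
move: (_ `^ _) (Num.sqrt (1 - beta2)) (Num.sqrt (1 - z)) (Num.sqrt 2) (Num.sqrt (2 * G))
  A0 B0 C0 D0 => A B C D Q A0 B0 C0 D0 H.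
have -> : gamma / B * (2 * (D / (sigma * (D * C)) * (U / (1 - z)))) =
  gamma * U / (B * sigma * (1 - z)) * (2 / C).
  by field; rewrite !gt_eqF.
have -> : 15 * (gamma * Q / (sigma * A * (1 - z) * B) * U) =
  gamma * U / (B * sigma * (1 - z)) * (15 * Q / A).
  by field; rewrite !gt_eqF.
apply: ler_wpM2l; first by rewrite divr_ge0 ?mulr_ge0 ?(ltW g0) ?(ltW B0) ?(ltW s0) ?(ltW q0).
by rewrite ler_pdivrMr// mulrAC ler_pdivlMr.
Qed.

Lemma sum_ord_le (R : realType) (F : nat -> R) (m n : nat) : (m <= n)%N ->
  (forall k, 0 <= F k) -> \sum_(k < m) F k <= \sum_(k < n) F k.
Proof.
move=> mn F0; rewrite (big_ord_widen n F mn) big_mkcond.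
by apply: ler_sum => k _; case: ifP.
Qed.

Theorem theorem4 (R : realType) (l Delta sigma : R) (T : nat)
    (beta1 beta2 gamma zeta v0 : R) (m0 : 'rV[R]_2)
    (hl : 0 < l) (hDelta : 0 < Delta) (hsigma : 0 < sigma) (hT : (1 < T)%N)
    (hbeta1 : 0 <= beta1 <= 1) (hbeta2 : 0 <= beta2 < 1) (hgamma : 0 < gamma)
    (hzeta : 1 / 2 < zeta < 1) (hv0 : 0 < v0) :
  exists (f : 'rV[R]_2 -> R) (x0 : 'rV[R]_2) (P : probability (borel_space R 2) R),
    [/\ smooth l f,
        ((f x0)%:E - ereal_inf (range (fun x => (f x)%:E)) <= Delta%:E)%E,
        zero_mean P,
        (noise_variance P <= (sigma ^+ 2)%:E)%E &
        forall (d : measure_display) (Omega : measurableType d)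
               (Pr : probability Omega R) (xi : nat -> {RV Pr >-> borel_space R 2}),
          iid xi P ->
          let g (x z : 'rV[R]_2) := grad f x + z in
          let gam (t : nat) := gamma / Num.sqrt t.+1%:R in
          let x (w : Omega) (t : nat) :=
            pos (amsgrad_norm beta1 beta2 gam g x0 m0 v0 (fun s => xi s w) t) in
          let bound :=
            Num.sqrt (Delta /
              (16 * Num.max (1 / l)
                 (gamma * Num.sqrt (2 * Gamma (1 - zeta / 2)) /
                    (sigma * (expR 1 * (1 / zeta - 1)) `^ (zeta / 2) *
                     (1 - zeta) * Num.sqrt (1 - beta2)) *
                    (T%:R `^ (1 - zeta) - zeta)))) in
          ((1 / 2)%:E <=
             Pr [set w | (bound <=
               \big[Num.min/enorm (grad f (x w 0%N))]_(t < T)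
                  enorm (grad f (x w t)))%R])%E].
Proof.
set S := gamma * _ / _ * _; set M := Num.max (1 / l) S; set c := Num.sqrt (Delta / (16 * M)).
case/andP: (hzeta) => z12 z1; case/andP: (hbeta2) => b20 b21.
have lM : 1 / l <= M by rewrite le_max lexx.
have SM : S <= M by rewrite le_max lexx orbT.
have M0 : 0 < M by apply: lt_le_trans lM; rewrite divr_gt0.
have c2 : c ^+ 2 = Delta / (16 * M).
  by rewrite sqr_sqrtr// divr_ge0 ?ltW// mulr_gt0.
have c0 : 0 < c by rewrite sqrtr_gt0 divr_gt0// mulr_gt0.
(* This makes the slope l a of the plateau equal to c. *)
pose a := c / l; have a0 : 0 <= a by rewrite divr_ge0 ?ltW.
have la : l * a = c by rewrite /a mulrC divfK// gt_eqF.
pose s : R := if 0 <= m0 0 0 then -1 else 1.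
have s1 : s ^+ 2 = 1 by rewrite /s; case: ifP; rewrite ?sqrrN expr1n.
have sm0 : s * m0 0 0 <= 0.
  rewrite /s; case: ifPn; first by rewrite mulN1r oppr_le0.
  by rewrite -ltNge mul1r => /ltW.
pose x0 : 'rV[R]_2 := (s * (a + c * (15 * M))) *: delta_mx 0 0.
have x0E : s * x0 0 0 = a + l * a * (15 * M).
  by rewrite !mxE !eqxx mulr1 mulrA -expr2 s1 mul1r la.
pose th := zeta - 1 / 2; pose q := Num.sqrt (1 - zeta).
have th0 : 0 < th by rewrite subr_gt0.
have th1 : th < 1 / 2 by rewrite /th; lra.
have q0 : 0 < q by rewrite sqrtr_gt0 subr_gt0.
(* Since 1 - 2 th = 2 (1 - zeta), this makes cx^2 / (1 - 2 th) equal to sigma^2. *)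
pose cx := sigma * (Num.sqrt 2 * q).
have cx0 : 0 < cx by rewrite !mulr_gt0// sqrtr_gt0.
exists (plateau l a s), x0, (noise (noise_level cx th T.-1) T.-1); split.
- exact: smooth_plateau.
- have fx0 : plateau l a s x0 <= Delta.
    rewrite /plateau x0E la huber_ge//; last by rewrite lerDl !mulr_ge0// ltW.
    (* As 1/l <= M, this is at most 16 M c^2 = Delta: of the constant 16, 15 is spent on the
       distance and 1 covers the curved part. *)
    have -> : l * (a * (a + c * (15 * M)) - a ^+ 2 / 2) =
        c ^+ 2 * ((1 / l) / 2 + 15 * M).
      by rewrite -la; field; rewrite gt_eqF.
    rewrite c2 mulrAC ler_pdivrMr ?mulr_gt0// ler_pM2l//; lra.
  apply: (@le_trans _ _ (plateau l a s x0)%:E); last by rewrite lee_fin.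
  rewrite -[leRHS]sube0 leeB//; apply: le_ereal_inf_tmp => _ [x _ <-].
  by rewrite lee_fin mulr_ge0 ?huber_ge0// ltW.
- exact: noise_zero_mean.
- rewrite noise_varianceE lee_fin.
  apply: (le_trans (level_variance cx T.-1 th0 th1)).
  rewrite /cx !exprMn !sqr_sqrtr ?subr_ge0 ?(ltW z1)//.
  rewrite le_eqVlt; apply/orP; left; apply/eqP; rewrite /th; field.
  by apply/eqP; lra.
move=> d Omega Pr xi iidP; lazy zeta.
pose gam (t : nat) := gamma / Num.sqrt t.+1%:R : R.
pose x (w : Omega) t := pos (ams_run l a s beta1 beta2 v0 gam x0 m0 (fun k => xi k w) t).
have T0 : (0 < T)%N by exact: ltnW.
pose U := T%:R `^ (1 - zeta) - zeta.
have U0 : 0 < U.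
  rewrite subr_gt0 (lt_le_trans z1)// -[leLHS](powRr0 T%:R) ler_powR ?subr_ge0 ?(ltW z1)//.
  by rewrite ler1n.
(* Twice the bound on the mean, for Markov's inequality at level 1/2. *)
pose L := 2 * (Num.sqrt 2 / cx * (U / (1 - zeta))).
have L0 : 0 < L by rewrite !(mulr_gt0, divr_gt0, invr_gt0)// ?sqrtr_gt0// subr_gt0.
(* The default value of the minimum is the term t = 0, which is among the indices because T > 0. *)
suff : ((1 / 2)%:E <= Pr [set w | forall t, (t < T)%N ->
    (c <= enorm (grad (plateau l a s) (x w t)))%R])%E.
  move=> /le_trans; apply; rewrite le_eqVlt; apply/orP; left; apply/eqP.
  rewrite /x /ams_run; congr (Pr _); apply/seteqP; split => w /= H.
    by apply: le_bigmin => [|t _]; [exact: (H 0%N T0)|exact: (H t (ltn_ord t))].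
  by move=> t tT; apply: (le_trans H); rewrite -[t]/(nat_of_ord (Ordinal tT)); exact: bigmin_le_cond.
apply: (noise_sum_half cx0 th0 th1 iidP (K := T) (L := L)) => //.
- by rewrite prednK.
- by rewrite /L ler_pM2l//; exact: weighted_sum_le.
- exact: (measurable_grad_ge a beta1 beta2 gam x0 m0 hl s1
    (xi := fun t => xi t) (fun t => measurable_funPT (xi t)) hv0).
move=> w zw Hm t tT.
have b0 : 0 < 1 - beta2 by rewrite subr_gt0.
have B0 : 0 < Num.sqrt (1 - beta2) by rewrite sqrtr_gt0.
pose v k := vhatsq (ams_run l a s beta1 beta2 v0 gam x0 m0 (fun k => xi k w) k).
have v_gt0 k : 0 < v k by exact: run_vhatsq_gt0.
have gam0 k : 0 <= gam k by rewrite divr_ge0 ?sqrtr_ge0// ltW.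
rewrite -la.
apply: (@run_grad_ge _ l a s beta1 beta2 v0 gam x0 m0 hl a0 s1 (fun k => xi k w) t (15 * M)) => //.
  by move=> k kt; apply: zw; exact: ltn_trans kt tT.
apply: (@le_trans _ _ (\sum_(k < T) gam k / Num.sqrt (v k.+1))).
  apply: (sum_ord_le (F := fun k => gam k / Num.sqrt (v k.+1))) => [|k].
    exact: ltnW.
  by rewrite divr_ge0 ?sqrtr_ge0.
have HS : \sum_(k < T) (Num.sqrt k.+1%:R)^-1 /
    (Num.sqrt (v k.+1) / Num.sqrt (1 - beta2)) < L.
  (* Step k divides by the normalization updated with sample k, hence the index k+1: it dominates
     all samples up to k. *)
  apply: (Hm (fun k => Num.sqrt (v k.+1) / Num.sqrt (1 - beta2))) => k j kT jk.
  rewrite ler_pdivlMr// -sqrtr_sqr -sqrtrM ?sqr_ge0//.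
  by rewrite ler_wsqrtr// mulrC; exact: run_vhatsq.
have -> : \sum_(k < T) gam k / Num.sqrt (v k.+1) =
    gamma / Num.sqrt (1 - beta2) * \sum_(k < T) (Num.sqrt k.+1%:R)^-1 /
      (Num.sqrt (v k.+1) / Num.sqrt (1 - beta2)).
  rewrite mulr_sumr; apply: eq_bigr => k _; rewrite /gam; field.
  by rewrite !gt_eqF ?sqrtr_gt0.
have gB : 0 <= gamma / Num.sqrt (1 - beta2) by rewrite divr_ge0 ?ltW.
apply: (le_trans (ler_wpM2l gB (ltW HS))).
have GG : expR (- 1) <= Gamma (1 - zeta / 2) :> R.
  by apply: Gamma_ge; apply/andP; split; lra.
apply: (le_trans (rate_le hgamma hsigma b21 hzeta (ltW U0) GG)).
by rewrite ler_pM2l.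
Qed.
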